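(* Let $a, d_1,\dots,d_k$ be positive integers ($k\ge 1$), and let $D_a(d_1,\dots,d_k)$ be the generalized Douglas region defined in the context, satisfying the standing assumptions (the diagonal $\ell'$ passes through white unit squares, and the southwestern and northeastern boundaries do not intersect). Let $w$ be its width and $\mathcal{C}$ its number of regular cells. Assume that the vertices $B$ and $D$ lie on the same horizontal line. Then the number of tilings of $D_a(d_1,\dots,d_k)$ is $$\operatorname{M}(D_a(d_1,\dots,d_k)) = 2^{\mathcal{C}-w(w+1)/2}.$$
   Context: Work in the square lattice of the plane. A ''diagonal'' means a southwest-to-northeast lattice line $x-y=c$ with $c\in\mathbb{Z}$; the unit of distance between diagonals is $\sqrt2/2$, so consecutive diagonals are at distance $1$. Fix two diagonals $\ell$ and $\ell'$, with $\ell'$ below $\ell$, at distance $d_1+\dots+d_k$ apart. Draw in $k-1$ diagonals strictly between them so that the distance from $\ell$ to the top drawn-in diagonal is $d_1$, the distances between successive drawn-in diagonals (from the top) are $d_2,\dots,d_{k-1}$, and the distance from the bottom drawn-in diagonal to $\ell'$ is $d_k$. Drawn-in diagonals cut the unit squares they cross into two triangles. This gives a new lattice whose fundamental regions (''cells'') are unit squares and right triangles, the triangles occurring only along drawn-in diagonals. Color the cells black and white so that cells sharing an edge have opposite colors and the cells crossed by $\ell$ are white. Region $D_a(d_1,\dots,d_k)$: Start at a lattice point $A$ on $\ell$ and take unit steps south or east, each step chosen so that the cell on its right is black, until reaching a lattice point $B$ on $\ell'$; this path is the northeastern boundary. Let $D$ be the lattice point on $\ell$ to the left of $A$ with $|AD|=a\sqrt2$.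 The southwestern boundary is obtained by reflecting the northeastern boundary across the perpendicular bisector of $AD$ (reversing step directions); it meets $\ell'$ at a point $C$. Join $D$ to $A$ by a zigzag lattice path of alternating east and north steps starting with a north step, and join $B$ to $C$ by a zigzag path of alternating west and south steps starting with a south step. The region enclosed by these four boundary paths is the generalized Douglas region $D_a(d_1,\dots,d_k)$, with vertices $A,B,C,D$. Standing assumptions: $\ell'$ passes through white unit squares, and the southwestern and northeastern boundaries do not intersect. A tile is the union of two cells sharing an edge; a tiling is a covering of the region by tiles without gaps or overlaps; $\operatorname{M}(R)$ is the number of tilings of $R$. Triangular cells are ''up-pointing'' if they point away from $\ell'$ and ''down-pointing'' if they point toward $\ell'$. A cell is regular if it is a black square or a black up-pointing triangle. The width is $w=|BC|/\sqrt2$, the number of white squares in the bottom line of cells. Special cases: for $k=1$, $a=d_1=n$ the region is the Aztec diamond of order $n$ (all unit squares inside $|x|+|y|=n+1$). *)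

(* Defs.v *)
(* Generalized Douglas regions D_a(d_1,...,d_k).
   Coordinates (fixed WLOG, everything is invariant under translation along l):
   - lattice points are (x,y) : int * int; a "diagonal" is a line x - y = c;
   - l  is the diagonal x - y = 0, and A = (0,0) is on l;
   - offsets are measured in the unit sqrt2/2, so the diagonal x - y = c is at
     distance c below l; l' is x - y = d_1 + ... + d_k;
   - the drawn-in diagonals are x - y = d_1 + ... + d_j, for 1 <= j <= k-1. *)
From HB Require Import structures.
From mathcomp Require Import all_boot all_order all_algebra.
Set Implicit Arguments. Unset Strict Implicit. Unset Printing Implicit Defensive.
Import Order.TTheory GRing.Theory Num.Theory.
Local Open Scope ring_scope.

Section Douglas.
Variables (a : nat) (d : seq nat).

Definition dist_ll' : nat := sumn d.

Definition drawn_list : seq int :=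
  [seq (sumn (take j d))%:Z | j <- iota 1 (size d).-1].
Definition drawn (z : int) : bool := z \in drawn_list.

(* A cell: (i, j, p) refers to the unit square [i,i+1] x [j,j+1] (which is
   crossed by the diagonal x - y = i - j) when p = None; when that diagonal is
   drawn in, the square is cut into the upper-left triangle p = Some true
   (up-pointing: it points away from l') and the lower-right triangle
   p = Some false (down-pointing). *)
Definition cell := (int * int * option bool)%type.

Definition valid (c : cell) : bool :=
  let: (i, j, p) := c in if p is None then ~~ drawn (i - j) else drawn (i - j).

(* Unit edges: (0,(i,j)) horizontal (i,j)-(i+1,j); (1,(i,j)) vertical
   (i,j)-(i,j+1); (2,(i,j)) diagonal (i,j)-(i+1,j+1). *)
Definition edge := (nat * (int * int))%type.
Definition edges_of (c : cell) : seq edge :=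
  let: (i, j, p) := c in
  match p with
  | None => [:: (0%N, (i, j)); (0%N, (i, j + 1)); (1%N, (i, j)); (1%N, (i + 1, j))]
  | Some true => [:: (1%N, (i, j)); (0%N, (i, j + 1)); (2%N, (i, j))]
  | Some false => [:: (0%N, (i, j)); (1%N, (i + 1, j)); (2%N, (i, j))]
  end.

Definition adjacent (c c' : cell) : bool :=
  (c != c') && has (fun e => e \in edges_of c') (edges_of c).

(* The black/white colouring: the (unique) colouring in which cells sharing an
   edge have opposite colours and the cells crossed by l are white.  A cell on
   the diagonal x - y = s is black iff s + (#drawn diagonals strictly above it)
   + [it is a down-pointing triangle] is odd. *)
Definition nabove (z : int) : nat := count (fun t => t < z) drawn_list.
Definition black (c : cell) : bool :=
  let: (i, j, p) := c in
  odd (absz ((i - j) + (nabove (i - j))%:Z + (nat_of_bool (p == Some false))%:Z)).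

(* Northeastern boundary: from A = (0,0), unit steps south or east, the step
   being south iff the cell on the right of the south step (the piece of the
   square [x-1,x] x [y-1,y] adjacent to its right edge) is black (otherwise
   the cell on the right of the east step is black).  Each step increases
   x - y by one, so ne s is the lattice point of the boundary on the diagonal
   at distance s below l, and B = ne (dist_ll'). *)
Definition ne_step (P : int * int) : int * int :=
  let: (x, y) := P in
  if black (x - 1, y - 1, if drawn (x - y) then Some false else None)
  then (x, y - 1) else (x + 1, y).
Definition ne (n : nat) : int * int := iter n ne_step (0, 0).

(* D = A - (a,a); reflection across the perpendicular bisector x + y = -a of AD *)
Definition ptD : int * int := (- a%:Z, - a%:Z).
Definition reflAD (P : int * int) : int * int :=
  let: (x, y) := P in (- a%:Z - y, - a%:Z - x).
Definition sw (n : nat) : int * int := reflAD (ne n).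

Definition ptB : int * int := ne dist_ll'.
Definition ptC : int * int := sw dist_ll'.

(* Cells of the region enclosed by the four boundary paths: the cells lying
   on a diagonal x - y = s with 0 <= s <= dist_ll' and, along that diagonal,
   strictly between the southwestern boundary point sw s and the northeastern
   boundary point ne s (measured by the coordinate x + y; the cell (i,j,_)
   has its centre at x + y = i + j + 1).  For s = 0 (resp. s = dist_ll') these
   are exactly the squares cut by l between D and A (resp. by l' between C
   and B), enclosed by the zigzag paths. *)
Definition in_region (c : cell) : bool :=
  let: (i, j, p) := c in
  [&& valid c, 0 <= i - j, i - j <= (dist_ll')%:Z,
      (sw (absz (i - j))).1 + (sw (absz (i - j))).2 < i + j + 1 &
      i + j + 1 < (ne (absz (i - j))).1 + (ne (absz (i - j))).2].

(* A finite box containing all the cells of the region. *)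
Definition box_N : nat := (a + dist_ll').+1.
Definition box_rng : seq int :=
  [seq (n%:Z - box_N%:Z) | n <- iota 0 (2 * box_N).+1].
Definition candidates : seq cell :=
  flatten [seq [seq (ij.1, ij.2, p) | p <- [:: None; Some true; Some false]]
          | ij <- [seq (i, j) | i <- box_rng, j <- box_rng]].
Definition region_seq : seq cell := [seq c <- candidates | in_region c].

Definition RCell := seq_sub region_seq.

Definition is_tile (t : {set RCell}) : bool :=
  [exists x : RCell, exists y : RCell,
     (t == [set x; y]) && adjacent (val x) (val y)].

Definition is_tiling (T : {set {set RCell}}) : bool :=
  partition T [set: RCell] && [forall t in T, is_tile t].
Definition ntilings : nat := #|[set T : {set {set RCell}} | is_tiling T]|.

Definition nregular : nat :=
  #|[set x : RCell | black (val x) && ((val x).2 != Some false)]|.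

(* width w = |BC| / sqrt 2 (B - C is parallel to (1,1)) *)
Definition width : nat := absz (ptB.1 - ptC.1).

End Douglas.

(* Main.v *)
(* Tilings are perfect matchings of the cells.  Call the squares of a diagonal,
   or its up-pointing triangles, or its down-pointing triangles, a row; rows
   alternate in colour, and in the coordinate q = i + a every row is an interval
   [lo, hi).  A cell at q is adjacent below to the cell at q only (across a
   drawn-in diagonal), or else to the cells at q and q + 1; from a white row the
   next row is then [lo, hi + 1) and the path goes east, from a black row it is
   [lo + 1, hi) and the path goes south.

   Match the rows from the top.  For a white row let x be the set of cells left
   to be matched downwards, for a black row the set of cells already matched
   upwards.  Across a drawn-in diagonal x is unchanged; on an east step each
   point of x moves by 0 or 1; on a south step x is replaced by a set with one
   point less interlacing with it.  By multilinearity, with p = #x, the number of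
   completions of x is 2^e det(C(x_i, j))_{i,j<p}, where e adds up the value of p
   over the remaining east steps: such a step replaces the row C(x, .) by
   C(x, .) + C(x + 1, .), and a south step is a telescoping sum.

   Initially x = {0, ..., a-1} has determinant 1, since B and D being on the same
   horizontal line means that there are a south steps.  The row reached by the
   j-th of the w east steps is regular and has j cells more than the set x being
   moved; hence e = C - w(w+1)/2. *)
Require Import Defs.
From HB Require Import structures.
From mathcomp Require Import all_boot all_order all_algebra.
From mathcomp Require Import zify ring.
Import Order.TTheory GRing.Theory Num.Theory.
Local Open Scope ring_scope.

(** * Perfect matchings *)

Section PerfectMatchings.
Variables (T : finType) (adj : rel T).

Definition is_edge (t : {set T}) : bool :=
  [exists x, exists y, (t == [set x; y]) && adj x y].

Definition matchings (A : {set T}) : {set {set {set T}}} :=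
  [set P | partition P A && [forall t in P, is_edge t]].

Lemma card_matchings0 : #|matchings set0| = 1%N.
Proof.
rewrite -(cards1 (set0 : {set {set T}})); congr #|pred_of_set _|.
apply/setP=> P; rewrite !inE; apply/andP/eqP => [[]|->].
  by rewrite partition_set0 => /eqP.
by rewrite partition_set0 eqxx; split=> //; apply/forall_inP=> t; rewrite inE.
Qed.

Hypothesis adj_irr : irreflexive adj.
Hypothesis adj_sym : symmetric adj.

(** Removing the block [[set x; y]] from a matching and putting it back are inverse bijections. *)
Lemma card_matchings_through (A : {set T}) x y :
  x \in A -> y \in A -> adj x y ->
  #|[set P in matchings A | [set x; y] \in P]| =
  #|matchings (A :\: [set x; y])|.
Proof.
move=> xA yA axy; set t := [set x; y].
have tn0 : t != set0 by apply/set0Pn; exists x; rewrite !inE eqxx.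
have tA : t \subset A by rewrite subUset !sub1set xA yA.
have -> : [set P in matchings A | t \in P] =
          [set t |: P | P in matchings (A :\: t)].
  apply/setP=> P; apply/idP/imsetP.
    rewrite inE => /andP[]; rewrite inE => /andP[pP eP] tP.
    exists (P :\ t); last by rewrite setD1K.
    rewrite inE; apply/andP; split; first exact: partitionD1.
    apply/forall_inP=> u; rewrite !inE => /andP[_ uP].
    exact: (forall_inP eP).
  case=> Q; rewrite !inE => /andP[pQ eQ] ->; rewrite !inE eqxx andbT /=.
  rewrite -(setID A t) (setIidPr tA) partitionU1 //=; last first.
    by rewrite -setI_eq0 setIDA setDIl setDv set0I.
  apply/forall_inP=> u; rewrite !inE => /orP[/eqP->|]; last exact: (forall_inP eQ).
  by apply/existsP; exists x; apply/existsP; exists y; rewrite eqxx.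
rewrite card_in_imset // => P Q; rewrite !inE => /andP[pP _] /andP[pQ _] /= ePQ.
have nt R : partition R (A :\: t) -> t \notin R.
  move=> pR; apply/negP=> tR.
  have := subsetP (partitionS pR tR) x.
  by rewrite !inE eqxx /= => /(_ isT).
by rewrite -(setU1K (nt _ pP)) ePQ setU1K // nt.
Qed.

(** Every matching pairs [x] with exactly one neighbour, so the matchings can be sorted by the
    partner of [x]. *)
Lemma card_matchings_peel (A : {set T}) x : x \in A ->
  #|matchings A| =
  (\sum_(y in A | adj x y) #|matchings (A :\: [set x; y])|)%N.
Proof.
move=> xA.
have partner P : P \in matchings A ->
  (\sum_(y in A | adj x y) ([set x; y] \in P))%N = 1%N.
  rewrite inE => /andP[pP eP].
  have [covP triv P0] := and3P pP; move/eqP: covP => covP.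
  have [y yA [axy xyP]] : exists2 y, y \in A & adj x y /\ [set x; y] \in P.
    have xcov : x \in cover P by rewrite covP.
    have pbP := pblock_mem xcov.
    have xpb : x \in pblock P x by rewrite mem_pblock.
    have /existsP[u /existsP[v /andP[/eqP euv auv]]] := forall_inP eP _ pbP.
    have inA z : z \in pblock P x -> z \in A.
      by apply/subsetP: z; apply: partitionS pP pbP.
    move: xpb pbP inA; rewrite euv !inE => /orP[]/eqP-> pbP inA.
      by exists v; rewrite ?inA ?inE ?eqxx ?orbT.
    exists u; first by rewrite inA // !inE eqxx.
    by rewrite setUC adj_sym.
  rewrite (bigD1 y) /= ?yA // xyP big1 // => z /andP[/andP[zA axz] zy].
  apply/eqP; rewrite eqb0; apply/negP=> xzP.
  have /eqP : [set x; z] = [set x; y].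
    apply/eqP; apply: contraT => ne.
    have /trivIsetP/(_ _ _ xzP xyP ne)/disjoint_setI0/setP/(_ x) := triv.
    by rewrite !inE eqxx.
  move/eqP/setP/(_ z); rewrite !inE eqxx orbT (negPf zy) orbF => /esym/eqP ezx.
  by rewrite ezx adj_irr in axz.
rewrite -sum1_card -(eq_bigr _ partner) exchange_big /=.
apply: eq_bigr => y /andP[yA axy]; rewrite -card_matchings_through //.
rewrite -sum1_card big_mkcond [RHS]big_mkcond /=.
by apply: eq_bigr => P _; rewrite [in RHS]inE; case: (P \in _); case: (_ \in P).
Qed.

End PerfectMatchings.
Arguments matchings {T}.
Arguments is_edge {T}.

(** * Determinants of binomial rows *)

Section RowDeterminants.
Variable R : comNzRingType.
Implicit Types (l : seq (nat -> R)) (u v w : nat -> R).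

(** Rows are functions on all of [nat], so that one row serves every size [n]; absent rows read as
    zero. *)
Definition rows_mx n l : 'M[R]_n :=
  \matrix_(i < n, j < n) nth (fun=> 0) l i j.
Definition rows_det n l : R := \det (rows_mx n l).

Lemma rows_det_linear n l1 l2 u v w (b : R) :
  (size l1 < n)%N -> (forall j, w j = u j + b * v j) ->
  rows_det n (l1 ++ w :: l2) =
  rows_det n (l1 ++ u :: l2) + b * rows_det n (l1 ++ v :: l2).
Proof.
move=> ln wE; rewrite -[X in X + _]mul1r.
have other f : row' (Ordinal ln) (rows_mx n (l1 ++ f :: l2)) =
    row' (Ordinal ln) (rows_mx n (l1 ++ w :: l2)).
  apply/matrixP=> i j; rewrite !mxE !nth_cat.
  case: ltnP => // le; rewrite -[(_ - _)%N]prednK //.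
  by rewrite subn_gt0 ltn_neqAle le andbT; apply: (neq_lift (Ordinal ln) i).
apply: (determinant_multilinear (i0 := Ordinal ln)) => //.
by apply/rowP=> j; rewrite !mxE !nth_cat ltnn subnn /= mul1r.
Qed.

Lemma rows_det_alternate n l i k :
  (i < k < n)%N -> nth (fun=> 0) l i = nth (fun=> 0) l k -> rows_det n l = 0.
Proof.
move=> /andP[ik kn] eq_ik.
apply: (determinant_alternate (i1 := Ordinal (ltn_trans ik kn)) (i2 := Ordinal kn)).
  by rewrite -val_eqE /= ltn_eqF.
by move=> j; rewrite !mxE /= eq_ik.
Qed.

(** A column operation: right multiplication by the bidiagonal matrix with [c] on the diagonal and 1
    just above it, of determinant [c ^+ n]. *)
Lemma rows_det_bidiagonal n l l' (c : R) :
  (forall i j, nth (fun=> 0) l' i j =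
     c * nth (fun=> 0) l i j + (if j is j'.+1 then nth (fun=> 0) l i j' else 0)) ->
  rows_det n l' = c ^+ n * rows_det n l.
Proof.
move=> l'E.
pose U : 'M[R]_n := \matrix_(i, j) (if i == j then c else (i.+1 == j)%:R).
have -> : rows_det n l' = \det (rows_mx n l *m U).
  congr (\det _); apply/matrixP=> i j; rewrite !mxE l'E (bigD1 j) //=.
  rewrite !mxE eqxx mulrC; congr (_ + _).
  case: j => -[|j] jn /=.
    by rewrite big1 // => k kj; rewrite !mxE (negPf kj) mulr0.
  rewrite (bigD1 (Ordinal (ltnW jn))) /=; last by rewrite -val_eqE /= ltn_eqF.
  rewrite !mxE -val_eqE /= (ltn_eqF (ltnSn j)) eqxx mulr1.
  rewrite big1 ?addr0 // => k /andP[kj kj1]; rewrite !mxE (negPf kj) /=.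
  by rewrite eqSS -val_eqE /= in kj1 *; rewrite (negPf kj1) mulr0.
rewrite det_mulmx mulrC -(det_tr U) det_trig; last first.
  apply/is_trig_mxP=> i j ij; rewrite !mxE -!val_eqE /=.
  by rewrite gtn_eqF // gtn_eqF // ltnW.
by rewrite (eq_bigr (fun=> c)) ?prodr_const ?card_ord // => i _; rewrite !mxE eqxx.
Qed.

Definition binom_row (x : nat) : nat -> R := fun j => 'C(x, j)%:R.

(** By Pascal's rule this is the difference of [binom_row x.+1] and [binom_row x]. *)
Definition binom_step (x : nat) : nat -> R :=
  fun j => if j is j'.+1 then 'C(x, j')%:R else 0.

Lemma binom_rowS x j : binom_row x.+1 j = binom_row x j + binom_step x j.
Proof.
case: j => [|j]; rewrite /binom_row /binom_step; first by rewrite !bin0 addr0.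
by rewrite binS natrD.
Qed.

Lemma rows_det_shift n s :
  rows_det n [seq binom_row x.+1 | x <- s] = rows_det n (map binom_row s).
Proof.
rewrite (rows_det_bidiagonal n (map binom_row s) _ 1) ?expr1n ?mul1r // => i j.
have [si|si] := ltnP i (size s); last first.
  by rewrite !nth_default ?size_map // mul1r; case: j => [|j]; rewrite addr0.
by rewrite !(nth_map 0%N) // mul1r binom_rowS /binom_step; case: j.
Qed.

(** Pascal's rule gives C(x,j) + C(x+1,j) = 2 C(x,j) + C(x,j-1), a column operation with [c = 2].
    All powers of two in the count arise here. *)
Lemma rows_det_double n s :
  rows_det n [seq (fun j => binom_row x j + binom_row x.+1 j) | x <- s] =
  2%:R ^+ n * rows_det n (map binom_row s).
Proof.
apply: rows_det_bidiagonal => i j.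
have [si|si] := ltnP i (size s); last first.
  by rewrite !nth_default ?size_map // mulr0; case: j => [|j]; rewrite addr0.
rewrite !(nth_map 0%N) // binom_rowS /binom_step addrA -mulr2n -(mulr_natl (binom_row _ _)).
by case: j.
Qed.

Lemma rows_det_iota n : rows_det n (map binom_row (iota 0 n)) = 1.
Proof.
rewrite /rows_det det_trig.
  rewrite big1 // => i _; rewrite !mxE (nth_map 0%N) ?size_iota //.
  by rewrite nth_iota // add0n /binom_row binn.
apply/is_trig_mxP=> i j ij; rewrite !mxE (nth_map 0%N) ?size_iota //.
by rewrite nth_iota // add0n /binom_row bin_small.
Qed.

Lemma rows_det_steps n s :
  rows_det n.+1 (map binom_step s) = 0.
Proof.
rewrite /rows_det (expand_det_col _ ord0) big1 // => i _; rewrite !mxE /=.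
have [si|si] := ltnP i (size s); last by rewrite nth_default ?size_map // mul0r.
by rewrite (nth_map 0%N) //= mul0r.
Qed.

(** Column 0 is zero except for a final 1; deleting it turns each [binom_step] into a
    [binom_row]. *)
Lemma rows_det_steps_row n s q : size s = n ->
  rows_det n.+1 (map binom_step s ++ [:: binom_row q]) =
  (-1) ^+ n * rows_det n (map binom_row s).
Proof.
move=> sn; rewrite /rows_det (expand_det_col _ ord0) (bigD1 ord_max) //=.
rewrite big1 ?addr0; last first.
  move=> i; rewrite -val_eqE /= => ine; rewrite !mxE nth_cat size_map sn.
  have si : (i < n)%N by rewrite ltn_neqAle ine -ltnS ltn_ord.
  by rewrite si (nth_map 0%N) ?sn //= mul0r.
rewrite !mxE nth_cat size_map sn ltnn subnn /= /binom_row bin0 mul1r.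
rewrite /cofactor addn0; congr (_ * \det _); apply/matrixP=> i j; rewrite !mxE.
by rewrite lift_max nth_cat size_map sn ltn_ord !(nth_map 0%N) ?sn.
Qed.

End RowDeterminants.
Arguments rows_det {R}.
Arguments binom_row {R}.
Arguments binom_step {R}.

(** * Matchings of layered graphs *)

Section Layers.
Local Open Scope nat_scope.
Variables (T : finType) (adj : rel T) (row pos : T -> nat).
Variables (L : nat) (hyp : pred nat) (lo hi : nat -> nat).

Definition in_row r q := lo r <= q < hi r.

Hypothesis adj_irr : irreflexive adj.
Hypothesis adj_sym : symmetric adj.
Hypothesis cell_inj :
  forall c c', row c = row c' -> pos c = pos c' -> c = c'.
Hypothesis row_le : forall c, row c <= L.
Hypothesis pos_in_row : forall c, in_row (row c) (pos c).
Hypothesis cell_ex :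
  forall r q, r <= L -> in_row r q -> exists2 c, row c = r & pos c = q.
Hypothesis adj_layers : forall c c', row c <= row c' ->
  adj c c' = (row c' == (row c).+1) &&
             ((pos c' == pos c) || ~~ hyp (row c) && (pos c' == (pos c).+1)).

Local Notation M A := #|matchings adj A|.

Let eq_M A B : A = B -> M A = M B.
Proof. by move=> ->. Qed.

(** What is left while row [r] is matched downwards: [P] and [Q] mark the unmatched cells of rows
    [r] and [r.+1], and all later rows are intact. *)
Definition layer r (P Q : pred nat) : {set T} :=
  [set c | [|| r.+1 < row c, (row c == r) && P (pos c)
             | (row c == r.+1) && Q (pos c)]].

Lemma eq_layer r (P P' Q Q' : pred nat) :
  (forall k, in_row r k -> P k = P' k) ->
  (forall k, in_row r.+1 k -> Q k = Q' k) -> layer r P Q = layer r P' Q'.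
Proof.
move=> eP eQ; apply/setP=> c; rewrite !inE; congr [|| _, _ | _].
  by case: eqP => //= e; apply: eP; rewrite -e pos_in_row.
by case: eqP => //= e; apply: eQ; rewrite -e pos_in_row.
Qed.

Lemma layer_next r (Q : pred nat) : layer r pred0 Q = layer r.+1 Q predT.
Proof. by apply/setP=> c; rewrite !inE; lia. Qed.

Lemma cell_eq c c' : (c == c') = (row c == row c') && (pos c == pos c').
Proof.
by apply/eqP/andP => [->|[/eqP ? /eqP ?]]; [rewrite !eqxx | apply: cell_inj].
Qed.

Lemma sum_cell_at r k (G : nat -> nat) : r <= L ->
  \sum_(y | (row y == r) && (pos y == k)) G (pos y) =
  if in_row r k then G k else 0.
Proof.
move=> rL; case: ifP => [rk|/negP nrk].
  have [c cr ck] := cell_ex _ _ rL rk.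
  rewrite (big_pred1 c) ?ck // => y.
  by rewrite /= cell_eq cr ck.
rewrite big_pred0 // => y; apply/andP=> -[/eqP yr /eqP yk]; apply: nrk.
by rewrite -yr -yk.
Qed.

(** No row above [r] is left, so the cell at [q] can only be paired downwards. *)
Lemma layer_peel r (P Q : pred nat) q : r < L -> P q -> in_row r q ->
  M (layer r P Q) =
  (if Q q && in_row r.+1 q then
     M (layer r (fun k => P k && (k != q)) (fun k => Q k && (k != q)))
   else 0) +
  (if [&& ~~ hyp r, Q q.+1 & in_row r.+1 q.+1] then
     M (layer r (fun k => P k && (k != q)) (fun k => Q k && (k != q.+1)))
   else 0).
Proof.
move=> rL Pq rq; have [c cr cq] := cell_ex _ _ (ltnW rL) rq.
have cl : c \in layer r P Q by rewrite inE cr cq eqxx Pq orbT.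
rewrite (card_matchings_peel _ _ adj_irr adj_sym _ _ cl).
pose G k := M (layer r (fun k => P k && (k != q)) (fun k' => Q k' && (k' != k))).
pose B y := [&& row y == r.+1, Q (pos y)
   & (pos y == q) || ~~ hyp r && (pos y == q.+1)].
have condE y : (y \in layer r P Q) && adj c y = B y.
  rewrite /B; have [cy|cy] := leqP (row c) (row y).
    rewrite inE adj_layers // cr cq.
    case: (row y =P r.+1) => [->|_]; last by rewrite !andbF.
    by rewrite ltnn [_ == r]eqn_leq ltnn /=.
  rewrite inE; move: cy; rewrite cr => ry.
  by rewrite (ltn_eqF ry) (ltn_eqF (leqW ry)) ltnNge (ltnW (leqW ry)).
rewrite (eq_bigl _ _ condE) (eq_bigr (fun y => G (pos y))) => [|y]; last first.
  case/and3P=> /eqP yr Qy _; apply: eq_M.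
  apply/setP=> z; rewrite !inE !cell_eq cr cq yr.
  lia.
rewrite (bigID (fun y => pos y == q)) /=; congr (_ + _).
  case Qq: (Q q) => /=; last first.
    rewrite big_pred0 // => y; apply/andP=> -[/and3P[_ Qy _] /eqP yq].
    by rewrite yq Qq in Qy.
  rewrite -/(G q) -(sum_cell_at _ _ G rL); apply: eq_bigl => y.
  by rewrite /B; case: (pos y =P q) => [->|_]; rewrite ?Qq; lia.
case: (boolP (hyp r)) => hr /=.
  by rewrite big_pred0 // => y; rewrite /B hr /= orbF -!andbA andbN !andbF.
case Qq: (Q q.+1) => /=; last first.
  rewrite big_pred0 // => y; apply/andP=> -[/and3P[_ Qy yq] nyq].
  by move: yq Qy; rewrite (negPf nyq) hr /= => /eqP->; rewrite Qq.
rewrite -/(G q.+1) -(sum_cell_at _ _ G rL); apply: eq_bigl => y.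
rewrite /B hr /=; case: (pos y =P q.+1) => [->|_]; rewrite ?Qq; lia.
Qed.

(** * Transfer from one row to the next *)

Definition odd_step r := odd r && ~~ hyp r.
(** Row 0 is white and colours alternate, so even steps are the east steps and odd steps the south
    steps. *)
Definition even_step r := ~~ odd r && ~~ hyp r.

Hypothesis hyp_step : forall r, r < L -> hyp r ->
  lo r.+1 = lo r /\ hi r.+1 = hi r.
Hypothesis even_step_ends : forall r, r < L -> even_step r ->
  lo r.+1 = lo r /\ hi r.+1 = (hi r).+1.
Hypothesis odd_step_ends : forall r, r < L -> odd_step r ->
  lo r.+1 = (lo r).+1 /\ hi r.+1 = hi r.

(** Each cell has one neighbour across its hypotenuse, so every pairing is forced. *)
Lemma matchings_hyp r (P : pred nat) : r < L -> hyp r ->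
  M (layer r P predT) = M (layer r.+1 (predC P) predT).
Proof.
move=> rL hr; have [eqlo eqhi] := hyp_step r rL hr.
rewrite -layer_next.
have scan n q : q + n = hi r ->
  M (layer r (fun k => (q <= k) && P k) (fun k => (k < q) ==> ~~ P k)) =
  M (layer r pred0 (predC P)).
  elim: n q => [|n IHn] q.
    rewrite addn0 => ->; apply: eq_M.
    apply: eq_layer => k; rewrite /in_row ?eqlo ?eqhi => /andP[_ kh] /=.
      by rewrite leqNgt kh.
    by rewrite kh.
  rewrite addnS -addSn => qn; rewrite -(IHn q.+1) //.
  have [/andP[Pq rq]|nPq] := boolP (P q && in_row r q).
    rewrite (layer_peel _ _ _ q) // ?leqnn // hr ltnn /=.
    have -> : in_row r.+1 q by rewrite /in_row eqlo eqhi.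
    rewrite addn0; apply: eq_M.
    by apply: eq_layer => k _ /=; have [->|kq] := eqVneq k q; rewrite ?Pq; lia.
  apply: eq_M; apply: eq_layer => k rk.
    by case: (eqVneq k q) rk => [->|kq] rk; [move: nPq; rewrite rk; lia | lia].
  rewrite /in_row eqlo eqhi in rk; case: (eqVneq k q) rk => [->|kq] rk; last by lia.
  by move: nPq; rewrite /in_row rk; lia.
rewrite -(scan (hi r) 0) //; apply: eq_M.
Qed.


Definition row_seq r (s : seq nat) := pairwise ltn s && all (in_row r) s.

Ltac mem_lia :=
  repeat match goal with
  | |- context [in_mem ?x ?A] => case: (in_mem x A)
  end; clear; lia.

(* [lia] would treat each of these boolean hypotheses as a case split. *)
Ltac arith_lia :=
  repeat match goal with
  | H : is_true (all _ _) |- _ => clear H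
  | H : is_true (pairwise _ _) |- _ => clear H
  | H : is_true (allrel _ _ _) |- _ => clear H
  | H : is_true (_ \in _) |- _ => clear H
  | H : is_true (~~ (_ \in _)) |- _ => clear H
  | H : is_true (~~ _ _) |- _ => clear H
  | H : is_true (odd_step _) |- _ => clear H
  | H : is_true (even_step _) |- _ => clear H
  | H : is_true (row_seq _ _) |- _ => clear H
  end; lia.

Lemma matchings_even_step r n (C : rat) : r < L -> even_step r ->
  (forall s, row_seq r.+1 s -> size s = n ->
     ((M (layer r.+1 (predC (mem s)) predT))%:R =
      C * rows_det n (map binom_row s))%R) ->
  forall s, row_seq r s -> size s = n ->
     ((M (layer r (mem s) predT))%:R =
      C * 2%:R ^+ n * rows_det n (map binom_row s))%R.
Proof.
move=> rL er IH; have [eqlo eqhi] := even_step_ends r rL er.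
have nhyp : ~~ hyp r by case/andP: er.
pose both x : nat -> rat := (fun j => binom_row x j + binom_row x.+1 j)%R.
(* [Y] lists the positions already taken in row [r.+1], [X] the points still to move. As [Y] lies
   weakly below [X], a point [x] can collide only at the target [x], never at [x.+1]. *)
have scan X : forall Y, row_seq r X -> row_seq r.+1 Y -> allrel leq Y X ->
  size Y + size X = n ->
  ((M (layer r (mem X) (predC (mem Y))))%:R =
   C * rows_det n (map binom_row Y ++ map both X))%R.
  elim: X => [|x X IHX] Y.
    move=> _ Yr _; rewrite addn0 cats0 => sY; rewrite -(IH _ Yr sY).
    by rewrite -layer_next.
  rewrite /row_seq /= allrel_consr => /andP[/andP[xX pX] /andP[xr aX]].
  move=> /andP[pY aY] /andP[Yx YX] sYX.
  rewrite (layer_peel r _ _ x) ?inE ?eqxx // natrD nhyp /=.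
  rewrite (rows_det_linear _ n _ _ (binom_row x) (binom_row x.+1) _ 1%R);
    last 2 first.
  - by rewrite size_map; arith_lia.
  - by move=> j; rewrite mul1r.
  have notX : x \notin X by apply/negP=> /(allP xX) /=; rewrite ltnn.
  have goX y : (y == x) || (y == x.+1) -> y \notin Y -> all (leq^~ y) Y ->
     ((M (layer r (fun k => (k \in x :: X) && (k != x))
                  (fun k => (k \notin Y) && (k != y))))%:R =
     C * rows_det n (map binom_row Y ++ binom_row y :: map both X))%R.
    move=> yx yY Yy.
    have -> : (map binom_row Y ++ binom_row y :: map both X =
               map binom_row (rcons Y y) ++ map both X)%R.
      by rewrite map_rcons cat_rcons.
    rewrite -IHX.
    - congr (_%:R)%R; apply: eq_M; apply: eq_layer => k _ /=.
        by rewrite in_cons; case: (k =P x) => [->|_]; rewrite ?andbF ?andbT ?(negPf notX).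
      by rewrite mem_rcons in_cons negb_or andbC.
    - by rewrite /row_seq pX aX.
    - rewrite /row_seq pairwise_rcons all_rcons pY aY !andbT; apply/andP; split.
        apply/allP=> z zY /=; rewrite ltn_neqAle (allP Yy z zY) andbT.
        by apply: contraNneq yY => <-.
      by move: xr; rewrite /in_row eqlo eqhi; arith_lia.
    - rewrite -cats1 allrel_catl YX allrel1l; apply/allP=> z /(allP xX) /=; arith_lia.
    - by rewrite size_rcons; arith_lia.
  have notS : x.+1 \notin Y by apply/negP=> /(allP Yx) /=; rewrite ltnn.
  rewrite mulrDr mul1r notS /=.
  have -> : in_row r.+1 x.+1 by move: xr; rewrite /in_row eqlo eqhi; arith_lia.
  have -> : in_row r.+1 x by move: xr; rewrite /in_row eqlo eqhi; arith_lia.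
  rewrite andbT; congr (_ + _)%R; last first.
    apply: goX => //; first by rewrite eqxx orbT.
    by apply/allP=> z /(allP Yx) /leqW.
  (* A taken target [x] allows no matching and puts two equal rows into the determinant. *)
  have [xY|xY] := boolP (x \in Y); last by rewrite goX ?eqxx.
  rewrite (rows_det_alternate _ n _ (index x Y) (size Y)) ?mulr0 //.
    by rewrite index_mem xY; arith_lia.
  rewrite !nth_cat size_map index_mem xY ltnn subnn /=.
  by rewrite (nth_map 0) ?index_mem // nth_index.
move=> s sr ss; rewrite -mulrA -rows_det_double -[map _ s]cat0s.
rewrite -(scan s [::]) //.
Qed.


(** The cells of row [r] strictly between consecutive missing positions [y < y'] can only cover
    positions among [y.+1], ..., [y'], and exactly one of these, [t], stays uncovered. Summed over
    [t], [binom_step t] telescopes to the difference of [binom_row y'.+1] and [binom_row y.+1]. *)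
Lemma matchings_odd_step r n (C : rat) : r < L -> odd_step r ->
  (forall s, row_seq r.+1 s -> size s = n ->
     ((M (layer r.+1 (mem s) predT))%:R =
      C * rows_det n (map binom_row s))%R) ->
  forall s, row_seq r s -> size s = n.+1 ->
     ((M (layer r (predC (mem s)) predT))%:R =
      C * rows_det n.+1 (map binom_row s))%R.
Proof.
move=> rL er IH; have [eqlo eqhi] := odd_step_ends r rL er.
have nhyp : ~~ hyp r by case/andP: er.
pose next x : nat -> rat := binom_row x.+1.
pose D q (c : bool) S Y : rat := rows_det n.+1
  (map binom_step S ++ nseq c (binom_row q) ++ map next Y).
(* Either the pending position moves on to [q.+1], or [q] stays uncovered and joins [S];
   [(-1) ^+ size S] absorbs the sign. *)
have D_split q S Y : size S <= n ->
    (D q true S Y = D q.+1 true S Y - D q false (rcons S q) Y)%R.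
  move=> Sn; rewrite /D.
  rewrite (rows_det_linear _ _ _ _ (binom_row q.+1) (binom_step q) _ (-1)%R).
  - by rewrite mulN1r map_rcons cat_rcons.
  - by rewrite size_map.
  - by move=> j; rewrite binom_rowS mulN1r addrK.
(* An uncovered position too many would push the last cell of row [r] out of row [r.+1]; on the
   other side, column 0 vanishes. *)
have D_end q S : D q false S [::] = 0%R by rewrite /D /= cats0 rows_det_steps.
(* The state of a left-to-right scan at position q: S lists the positions below
   q of row r.+1 left uncovered, c tells whether position q of row r.+1 is still
   uncovered, and Y lists the missing positions of row r from q on.  If c holds,
   the pending uncovered position ranges from q to the head y of Y, which
   contributes binom_row y.+1 - binom_row q to the determinant. *)
have scan m : forall q (c : bool) S Y,
    q + m = hi r -> (if c then lo r < q else lo r <= q < hi r) ->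
    row_seq r.+1 S -> all (ltn^~ q) S -> row_seq r Y -> all (leq q) Y ->
    size S + c + size Y = n.+1 ->
  ((M (layer r (fun k => (q <= k)%N && (k \notin Y))
               (fun k => [|| k \in S, (q < k)%N | c && (k == q)])))%:R =
   C * (-1) ^+ size S * D q c S Y)%R.
  elim: m => [|m IHm] q c S Y.
    rewrite addn0 => qhi; case: c => [_|]; last by rewrite -qhi; arith_lia.
    case: Y => [|y Y]; last first.
      move=> _ _ /andP[_ /andP[yr _]] /andP[qy _].
      by move: yr; rewrite /in_row -qhi; arith_lia.
    move=> Sr _ _ _; rewrite addn0 addn1 => -[Sn].
    (* Only the pending row is nonzero in column 0; the sign of its cofactor cancels the accumulated
       sign. *)
    rewrite /D /= rows_det_steps_row // Sn mulrA -[(C * _ * _)%R]mulrA -expr2.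
    rewrite sqrr_sign mulr1 -IH // -layer_next; congr (_%:R)%R; apply: eq_M.
    apply: eq_layer => k; rewrite /in_row ?eqhi => /andP[_ kh] /=.
      by rewrite qhi leqNgt kh.
    by rewrite qhi ltnNge (ltnW kh) /= ltn_eqF // orbF.
  rewrite addnS -addSn => qm cond Sr Sq Yr Yq sz.
  have qhi : q < hi r by arith_lia.
  have qS : q \notin S by apply/negP=> /(allP Sq) /=; rewrite ltnn.
  have ltS k : (k \in S) ==> (k < q) by apply/implyP=> /(allP Sq).
  have Sq1 : all (ltn^~ q.+1) S by apply/allP=> k /(allP Sq) /= /ltnW.
  have rq : in_row r q by rewrite /in_row; case: (c) cond; arith_lia.
  have Srq : lo r < q -> row_seq r.+1 (rcons S q).
    case/andP: Sr => pS aS lq.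
    rewrite /row_seq pairwise_rcons all_rcons Sq pS aS !andbT.
    by rewrite /in_row eqlo eqhi; arith_lia.
  have Srq1 : all (ltn^~ q.+1) (rcons S q) by rewrite all_rcons Sq1 /= ltnSn.
  have [qY|qY] := boolP (q \in Y).
    have [Y' eY] : exists Y', Y = q :: Y'.
      case: Y qY Yr Yq {sz} => // y Y qY /andP[/andP[yY _] _] /andP[qy _].
      exists Y; congr (_ :: _); move: qY; rewrite inE => /orP[/eqP//|/(allP yY) /=].
      by arith_lia.
    move: Yr Yq sz; rewrite eY => /andP[/= /andP[qY' pY'] /andP[_ aY']] _ sz.
    have Yr' : row_seq r Y' by rewrite /row_seq pY'.
    case: c cond sz => cond sz.
      rewrite D_split; last by move: sz => /=; arith_lia.
      (* The cell of row [r] at [q] is missing, so position [q] must stay uncovered; the other term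
         contains [binom_row q.+1] twice. *)
      have -> : D q.+1 true S (q :: Y') = 0%R.
        apply: (rows_det_alternate _ _ _ (size S) (size S).+1).
          by move: sz => /=; arith_lia.
        by rewrite !nth_cat !size_map ltnn subnn [_.+1 < size S]ltnNge leqnSn subSnn.
      rewrite sub0r mulrN -mulNr -mulrN.
      have -> : (- (-1) ^+ size S = (-1) ^+ size (rcons S q) :> rat)%R.
        by rewrite size_rcons exprS mulN1r.
      rewrite -[D _ _ _ _]/(D q.+1 true (rcons S q) Y') -IHm //; last 3 first.
      - by move: cond; arith_lia.
      - exact: Srq.
      - by rewrite size_rcons; move: sz => /=; arith_lia.
      congr (_%:R)%R; apply: eq_M; apply: eq_layer => k _ /=.
        by rewrite in_cons; mem_lia.
      by rewrite mem_rcons in_cons; move: (ltS k); mem_lia.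
    (* [next q] is [binom_row q.+1]: the head of [Y] becomes the pending row. *)
    have -> : D q false S (q :: Y') = D q.+1 true S Y' by [].
    rewrite -IHm //; last 2 first.
    - by move: cond; arith_lia.
    - by move: sz => /=; arith_lia.
    congr (_%:R)%R; apply: eq_M; apply: eq_layer => k _ /=.
      by rewrite in_cons; mem_lia.
    by arith_lia.
  have Yq1 : all (leq q.+1) Y.
    apply/allP=> k kY /=; rewrite ltn_neqAle (allP Yq k kY) andbT.
    by apply: contraNneq qY => ->.
  rewrite (layer_peel r _ _ q) ?leqnn ?qY //= (negPf qS) ltnn eqxx nhyp.
  rewrite orbT /= andbT natrD.
  have Yend : ~~ (q.+1 < hi r) -> Y = [::].
    case: (Y) Yr Yq1 => // y Y' /andP[_ /andP[yr _]] /andP[qy _].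
    by move: yr; rewrite /in_row; arith_lia.
  have rq1 : in_row r.+1 q.+1 = (q.+1 < hi r).
    by move: rq; rewrite /in_row eqlo eqhi; arith_lia.
  have -> : in_row r.+1 q = (lo r < q) by rewrite /in_row eqlo eqhi; arith_lia.
  rewrite rq1.
  case: c cond sz => cond sz /=.
    rewrite cond D_split; last by move: sz => /=; arith_lia.
    rewrite mulrBr; congr (_ + _)%R.
      rewrite -IHm //; last by arith_lia.
      congr (_%:R)%R; apply: eq_M; apply: eq_layer => k _ /=; move: (ltS k); mem_lia.
    rewrite -mulNr -mulrN.
    have -> : (- (-1) ^+ size S = (-1) ^+ size (rcons S q) :> rat)%R.
      by rewrite size_rcons exprS mulN1r.
    case: ifPn => [q1|/Yend ->]; last by rewrite D_end mulr0.
    rewrite -[D _ _ _ _]/(D q.+1 false (rcons S q) Y) -IHm //; last 3 first.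
    - by arith_lia.
    - exact: Srq.
    - by rewrite size_rcons; move: sz => /=; arith_lia.
    congr (_%:R)%R; apply: eq_M; apply: eq_layer => k _ /=; first by mem_lia.
    by rewrite mem_rcons in_cons; move: (ltS k); mem_lia.
  rewrite add0r.
  case: ifPn => [q1|/Yend ->]; last by rewrite D_end mulr0.
  rewrite -[D _ _ _ _]/(D q.+1 false S Y) -IHm //; last by arith_lia.
  congr (_%:R)%R; apply: eq_M; apply: eq_layer => k _ /=; move: (ltS k); mem_lia.
move=> s sr ss.
have lohi : lo r < hi r.
  by case: s sr ss => // y s /andP[_ /andP[yr _]] _; move: yr; rewrite /in_row; arith_lia.
(* The scan starts with nothing pending, because [lo r] is not a position of row [r.+1]. *)
rewrite -rows_det_shift; have := scan (hi r - lo r) (lo r) false [::] s.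
rewrite mulr1 => <- //.
- congr (_%:R)%R; apply: eq_M; apply: eq_layer => k; rewrite /in_row ?eqlo => /andP[kl _] //=.
  + by rewrite kl.
  + by rewrite kl.
- by arith_lia.
- by rewrite leqnn.
- by case/andP: sr => _ /allP sr; apply/allP=> k /sr /andP[].
Qed.


(** Each south step loses one point and none remain at the bottom, so this is the number of points
    at row [r]. *)
Definition odd_steps_from r := \sum_(r <= i < L) odd_step i.

Definition weight_from r :=
  \sum_(r <= i < L) (if even_step i then odd_steps_from i else 0).

Lemma odd_steps_fromS r : r < L ->
  odd_steps_from r = odd_step r + odd_steps_from r.+1.
Proof. by move=> rL; rewrite /odd_steps_from (big_ltn rL). Qed.

Lemma matchings_layer_det r s : ~~ odd L -> r <= L ->
  row_seq r s -> size s = odd_steps_from r ->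
  ((M (layer r (if odd r then predC (mem s) else mem s) predT))%:R =
   2%:R ^+ weight_from r * rows_det (odd_steps_from r) (map binom_row s) :> rat)%R.
Proof.
move=> Leven; move Lr: (L - r) => m; elim: m r Lr s => [|m IHm] r Lr s rL sr ss.
  (* The bottom row is white since [L] is even, and no point is left in it: the graph and the
     determinant are empty. *)
  have eL : r = L by arith_lia.
  subst r.
  move: ss; rewrite (negPf Leven) /weight_from /odd_steps_from !big_geq //.
  move=> /size0nil ->; rewrite /rows_det det_mx00 mulr1 expr0.
  rewrite (eq_M _ set0) ?card_matchings0 //.
  apply/setP=> c; rewrite !inE /= andbF /=.
  by have := row_le c; arith_lia.
have ltrL : r < L by arith_lia.
have Lr1 : L - r.+1 = m by arith_lia.
have {}IHm s' := IHm r.+1 Lr1 s' ltrL.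
have weightE : weight_from r =
    (if even_step r then odd_steps_from r else 0) + weight_from r.+1.
  by rewrite /weight_from (big_ltn ltrL).
have stepsE := odd_steps_fromS r ltrL.
rewrite weightE stepsE in ss *.
case hr: (hyp r).
  have [eqlo eqhi] := hyp_step r ltrL hr.
  rewrite /even_step /odd_step hr !andbF !add0n in ss *.
  rewrite -IHm //; last by rewrite /row_seq /in_row eqlo eqhi.
  rewrite matchings_hyp // /=; congr (_%:R)%R; apply: eq_M.
  by apply: eq_layer => k _ //; case: (odd r) => //=; rewrite ?negbK.
case odr: (odd r).
  have [oe oo] : even_step r = false /\ odd_step r.
    by rewrite /even_step /odd_step hr odr.
  rewrite oe oo add0n add1n in ss *.
  apply: matchings_odd_step => // t tr ts; rewrite -IHm //.
  by rewrite /= odr.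
have [oe oo] : even_step r /\ odd_step r = false.
  by rewrite /even_step /odd_step hr odr.
rewrite oe oo add0n in ss *.
rewrite addnC exprD; apply: matchings_even_step => // t tr ts; rewrite -IHm //.
by rewrite /= odr.
Qed.

Lemma matchings_layers : ~~ odd L -> lo 0 = 0 -> hi 0 = odd_steps_from 0 ->
  ((M setT)%:R = 2%:R ^+ weight_from 0 :> rat)%R.
Proof.
move=> Leven lo0 hi0.
have := matchings_layer_det 0 (iota 0 (odd_steps_from 0)) Leven.
rewrite rows_det_iota mulr1 => <- //; last 2 first.
- rewrite /row_seq; apply/andP; split.
    by rewrite -(sorted_pairwise ltn_trans) iota_ltn_sorted.
  by apply/allP=> k; rewrite mem_iota /in_row lo0 hi0.
- by rewrite size_iota.
congr (_%:R)%R; apply: eq_M; apply/setP=> c; rewrite !inE /= mem_iota.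
have := pos_in_row c; rewrite /in_row; case: (row c) => [|[|k]] //=.
by rewrite lo0 hi0; lia.
Qed.

(** * Counting the cells of the rows *)

Definition even_steps r := \sum_(0 <= i < r) even_step i.

Lemma layer_bounds r : r <= L ->
  hi r = hi 0 + even_steps r /\ lo r + odd_steps_from r = lo 0 + odd_steps_from 0.
Proof.
elim: r => [|r IHr] rL; first by rewrite /even_steps big_geq ?addn0.
have [eh el] := IHr (ltnW rL).
rewrite /even_steps big_nat_recr //= -/(even_steps r).
rewrite -el (odd_steps_fromS r rL).
case hr: (hyp r).
  have [-> ->] := hyp_step r rL hr.
  by rewrite eh /even_step /odd_step hr !andbF; arith_lia.
case odr: (odd r).
  have [oe oo] : even_step r = false /\ odd_step r.
    by rewrite /even_step /odd_step hr odr.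
  by have [-> ->] := odd_step_ends r rL oo; rewrite eh oe oo; arith_lia.
have [oe oo] : even_step r /\ odd_step r = false.
  by rewrite /even_step /odd_step hr odr.
by have [-> ->] := even_step_ends r rL oe; rewrite eh oe oo; arith_lia.
Qed.

Lemma sum_nat_indicator a b p : \sum_(a <= k < b) (p == k) = (a <= p < b).
Proof.
rewrite -mem_index_iota -count_uniq_mem ?iota_uniq // -sum1_count.
by rewrite [RHS]big_mkcond; apply: eq_bigr => k _ /=; rewrite eq_sym; case: eqP.
Qed.

Lemma card_row r : r <= L -> #|[set c | row c == r]| = hi r - lo r.
Proof.
move=> rL; rewrite -sum1_card.
rewrite (eq_bigr (fun c => \sum_(lo r <= k < hi r) (pos c == k))); last first.
  move=> c; rewrite inE => /eqP rc; rewrite sum_nat_indicator.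
  by have := pos_in_row c; rewrite /in_row rc => ->.
rewrite exchange_big /= big_nat_cond.
rewrite (eq_bigr (fun=> 1)) => [|k /andP[rk _]].
  by rewrite -big_nat_cond sum_nat_const_nat muln1.
transitivity (\sum_(y | (row y == r) && (pos y == k)) 1).
  rewrite big_mkcondr /=; apply: eq_big => c; first by rewrite inE.
  by case: eqP.
by rewrite (sum_cell_at _ _ (fun=> 1)) // /in_row rk.
Qed.

(** An even step [i] reaches a row of [odd_steps_from i + even_steps i + 1] cells. The first
    summands add up to the weight, the rest to 1 + 2 + ... + [even_steps L]. *)
Lemma card_even_step_targets :
  lo 0 = 0 -> hi 0 = odd_steps_from 0 ->
  #|[set c | odd (row c) && ~~ hyp (row c).-1]| =
  weight_from 0 + 'C((even_steps L).+1, 2).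
Proof.
move=> lo0 hi0.
have -> : #|[set c | odd (row c) && ~~ hyp (row c).-1]| =
          \sum_(0 <= i < L | even_step i) (hi i.+1 - lo i.+1).
  transitivity (\sum_(0 <= i < L | even_step i) \sum_(c | row c == i.+1) 1).
    rewrite (exchange_big_dep predT) //= -sum1_card big_mkcond.
    apply: eq_bigr => c _; rewrite inE.
    case: (row c) (row_le c) => [|r] rL.
      by rewrite /= big_pred0 // => i; rewrite andbF.
    rewrite -[_ && _]/(even_step r); case er: (even_step r).
      transitivity (nat_of_bool (0 <= r < L)); first by rewrite /= rL.
      rewrite -sum_nat_indicator [RHS]big_mkcond.
      apply: eq_bigr => i _ /=; rewrite eqSS.
      by case: eqP => [<-|]; rewrite ?er ?andbF.
    rewrite big_pred0 // => i; rewrite eqSS; case: eqP => [<-|]; rewrite ?er //.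
    by rewrite andbF.
  rewrite big_nat_cond [RHS]big_nat_cond; apply: eq_bigr => i /andP[/andP[_ iL] _].
  by rewrite -card_row // -sum1_card; apply: eq_bigl => c; rewrite inE.
have partial m : m <= L ->
  \sum_(0 <= i < m | even_step i) (hi i.+1 - lo i.+1) =
  \sum_(0 <= i < m) (if even_step i then odd_steps_from i else 0) +
  'C((even_steps m).+1, 2).
  elim: m => [|m IHm] mL; first by rewrite /even_steps !big_geq.
  rewrite big_mkcond /even_steps !big_nat_recr //= -big_mkcond IHm ?(ltnW mL) //.
  rewrite -/(even_steps m); case em: (even_step m); last by rewrite !addn0.
  have [eh el] := layer_bounds m (ltnW mL).
  have [-> ->] := even_step_ends m mL em.
  rewrite addn1 [in RHS]binS bin1; arith_lia.
exact: partial.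
Qed.

End Layers.

(** * The rows of a generalized Douglas region *)

(** Validity is not assumed, so any two different pieces of one square count as adjacent; in the
    region these are just the two triangles of a cut square. *)
Lemma adjacent_below (i j i' j' : int) (p p' : option bool) :
  i - j <= i' - j' ->
  adjacent (i, j, p) (i', j', p') =
  [&& i' - j' == i - j + 1, p != Some true, p' != Some false
    & (i' == i) || (i' == i + 1)] || [&& i' == i, j' == j & p != p'].
Proof.
move=> le; rewrite /adjacent !xpair_eqE.
have pE : ((Some true == Some false) = false) * ((Some false == Some true) = false)
  * (forall b : bool, ((Some b == None) = false) * ((None == Some b) = false)).
  by [].
by case: p => [[]|]; case: p' => [[]|];
  rewrite /= !inE !xpair_eqE /= ?eqxx ?pE; lia.
Qed.

Section Geometry.
Variables (a : nat) (d : seq nat).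
Hypothesis d_gt0 : all (fun x => 0 < x)%N d.
Local Notation N := (dist_ll' d).

Local Open Scope nat_scope.

Definition is_drawn (s : nat) := drawn d s.
(** A drawn-in diagonal carries two rows, any other one; [upper_row s] and [lower_row s] number the
    first and last row on diagonal [s], so that row parity is colour. *)
Definition upper_row (s : nat) := s + nabove d s.
Definition lower_row (s : nat) := s + nabove d s.+1.

Lemma sumn_take_lt i j : i < j <= size d -> sumn (take i d) < sumn (take j d).
Proof.
case/andP=> ij jd; rewrite -(cat_take_drop i (take j d)) take_takel ?(ltnW ij) //.
rewrite sumn_cat -[X in X < _]addn0 ltn_add2l.
have : all (fun x => 0 < x) (drop i (take j d)).
  by apply/allP=> x /mem_drop /mem_take /(allP d_gt0).
have : size (drop i (take j d)) = j - i by rewrite size_drop size_takel.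
by case: (drop _ _) => [|x s] /= sz; [lia | move=> /andP[]; lia].
Qed.

Lemma drawn_list_uniq : uniq (drawn_list d).
Proof.
rewrite map_inj_in_uniq ?iota_uniq // => i j; rewrite !mem_iota => ii jj /eqP.
rewrite eqz_nat => /eqP e; have [id jd] : i <= size d /\ j <= size d by lia.
case: (ltngtP i j) => // lt.
  by have := sumn_take_lt i j; rewrite lt jd e ltnn => /(_ isT).
by have := sumn_take_lt j i; rewrite lt id e ltnn => /(_ isT).
Qed.

Lemma is_drawn_bounds s : is_drawn s -> 0 < s < N.
Proof.
move/mapP=> [j]; rewrite mem_iota => jj [->].
have := sumn_take_lt 0 j; have := sumn_take_lt j (size d).
rewrite take0 take_size /dist_ll' /=; lia.
Qed.

Lemma naboveS (s : nat) : nabove d s.+1 = nabove d s + is_drawn s.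
Proof.
rewrite /is_drawn /drawn -count_uniq_mem ?drawn_list_uniq // /nabove.
rewrite -count_predUI.
rewrite [X in _ = _ + X](_ : _ = 0) ?addn0; last first.
  by rewrite (eq_count (a2 := pred0)) ?count_pred0 // => z /=; lia.
by apply: eq_count => z /=; lia.
Qed.

Lemma lower_rowE s : lower_row s = upper_row s + is_drawn s.
Proof. by rewrite /lower_row naboveS addnA. Qed.

Lemma upper_rowS s : upper_row s.+1 = (lower_row s).+1.
Proof. by []. Qed.

Lemma upper_row0 : upper_row 0 = 0.
Proof.
rewrite /upper_row add0n /nabove (eq_in_count (a2 := pred0)) ?count_pred0 //.
by move=> z /mapP[j _ ->] /=; lia.
Qed.

Lemma ltn_upper_row : {homo upper_row : s t / s < t}.
Proof.
apply: homo_ltn => [|s]; first exact: ltn_trans.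
by rewrite upper_rowS lower_rowE; lia.
Qed.

(** Inverts the row numbering; the search may stop at [r] because [r <= lower_row r]. *)
Definition diag r := find (fun s => r <= lower_row s) (iota 0 r.+1).

Lemma diag_bounds r : upper_row (diag r) <= r <= lower_row (diag r).
Proof.
have ex : has (fun s => r <= lower_row s) (iota 0 r.+1).
  by apply/hasP; exists r; [rewrite mem_iota; lia | rewrite /lower_row; lia].
have := ex; rewrite has_find size_iota -/(diag r) => dr.
have := nth_find 0 ex; rewrite -/(diag r) nth_iota // add0n => ->; rewrite andbT.
case e: (diag r) dr => [|s] dr; first by rewrite upper_row0.
have : s < diag r by rewrite e.
move/(before_find 0); rewrite nth_iota ?add0n; last by lia.
by rewrite upper_rowS ltnNge => ->.
Qed.

Lemma diag_eq r s : upper_row s <= r <= lower_row s -> diag r = s.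
Proof.
have := diag_bounds r => /andP[b1 b2] /andP[b3 b4].
case: (ltngtP (diag r) s) => // lt; have := ltn_upper_row _ _ lt.
  have : upper_row (diag r).+1 <= upper_row s.
    by case: (ltngtP (diag r).+1 s) => [/ltn_upper_row /ltnW||->] //; lia.
  by rewrite upper_rowS; lia.
have : upper_row s.+1 <= upper_row (diag r).
  by case: (ltngtP s.+1 (diag r)) => [/ltn_upper_row /ltnW||->] //; lia.
by rewrite upper_rowS; lia.
Qed.

Definition hypotenuse_step r := is_drawn (diag r) && (r == upper_row (diag r)).

Lemma diag_hypotenuse_step r : hypotenuse_step r -> diag r.+1 = diag r.
Proof.
case/andP=> dr /eqP e; apply: diag_eq; have := lower_rowE (diag r).
by rewrite dr; lia.
Qed.

Lemma diag_edge_step r : ~~ hypotenuse_step r ->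
  r = lower_row (diag r) /\ diag r.+1 = (diag r).+1.
Proof.
move=> nh; have e : r = lower_row (diag r).
  move: nh (diag_bounds r); rewrite /hypotenuse_step lower_rowE.
  by case: (is_drawn _) => /=; lia.
split=> //; apply: diag_eq; rewrite upper_rowS -e leqnn lower_rowE upper_rowS -e.
by rewrite leq_addr.
Qed.

(** * Boundary paths and positions *)

Definition souths s := \sum_(0 <= i < s) odd (lower_row i).
Definition easts s := \sum_(0 <= i < s) ~~ odd (lower_row i).

Lemma easts_souths s : easts s + souths s = s.
Proof.
rewrite /easts /souths -big_split /= -[RHS]subn0 -[RHS]muln1 -sum_nat_const_nat.
by apply: eq_bigr => i _; case: odd.
Qed.

Lemma neE s : ne d s = ((easts s)%:Z, - (souths s)%:Z)%R.
Proof.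
elim: s => [|s IHs]; first by rewrite /easts /souths !big_geq.
rewrite /ne iterS -/(ne d s) IHs /ne_step.
have -> : ((easts s)%:Z - - (souths s)%:Z = s :> int)%R.
  by rewrite opprK -PoszD easts_souths.
(* The cell to the right of a south step lies in the last row of diagonal [s]. *)
have -> : black d ((easts s)%:Z - 1, - (souths s)%:Z - 1,
    if drawn d s then Some false else None)%R = odd (lower_row s).
  rewrite /black.
  have -> : ((easts s)%:Z - 1 - (- (souths s)%:Z - 1) = s :> int)%R.
    by rewrite -[in RHS](easts_souths s) PoszD; ring.
  rewrite lower_rowE /is_drawn /upper_row; congr (odd _).
  by case: (drawn d s) => /=; lia.
rewrite /easts /souths !big_nat_recr //=; case: odd => /=.
  by congr (_, _); lia.
by congr (_, _); lia.
Qed.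

Definition cell_diag (c : cell) : nat := absz (c.1.1 - c.1.2)%R.
Definition cell_row (c : cell) : nat :=
  upper_row (cell_diag c) + (c.2 == Some false).
(** Inside the region this integer is nonnegative, so the absolute value only changes its type. *)
Definition cell_pos (c : cell) : nat := absz (c.1.1 + a%:Z)%R.

(** Substituting [s = easts s + souths s] turns the bounds on x + y into an interval for i + a,
    which is why i + a serves as the position. *)
Lemma in_regionE (i : int) (s : nat) p :
  in_region a d (i, i - s%:Z, p)%R =
  [&& (if p is None then ~~ is_drawn s else is_drawn s), s <= N
    & ((souths s)%:Z <= i + a%:Z)%R && (i + a%:Z < (a + easts s)%:Z)%R].
Proof.
rewrite /in_region /valid.
have -> : (i - (i - s%:Z) = s :> int)%R by ring.
rewrite absz_nat /sw neE /=; have := easts_souths s.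
rewrite /is_drawn; case: p => [b|] /= e; case: (drawn d s) => /=; lia.
Qed.

Lemma in_region_diag c : in_region a d c ->
  c = (c.1.1, c.1.1 - (cell_diag c)%:Z, c.2)%R.
Proof.
case: c => [[i j] p] /and4P[_ ge0 _ _]; rewrite /cell_diag /=.
by congr (_, _, _); lia.
Qed.


Lemma in_region_bounds c : in_region a d c ->
  let s := cell_diag c in
  [/\ s <= N, is_drawn s = isSome c.2,
      (c.1.1 + a%:Z)%R = (cell_pos c)%:Z & souths s <= cell_pos c < a + easts s].
Proof.
move=> cR; have := cR; rewrite {1}(in_region_diag _ cR) in_regionE.
move=> /and3P[pR sN pos_s]; split=> //; rewrite /cell_pos; try lia.
by case: (c.2) pR => [b|] // /negPf.
Qed.

Lemma diag_cell_row c : in_region a d c -> diag (cell_row c) = cell_diag c.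
Proof.
case/in_region_bounds=> _ pR _ _; apply: diag_eq.
rewrite /cell_row leq_addr lower_rowE leq_add2l /=.
by rewrite pR; case: (c.2) => [[]|].
Qed.

(** In the region -a <= i < N and 0 <= i - j <= N, so the box holds both coordinates. *)
Lemma mem_region_seq c : (c \in region_seq a d) = in_region a d c.
Proof.
rewrite mem_filter andb_idr // => cR.
have [sN _ ei /andP[lb ub]] := in_region_bounds _ cR.
have := easts_souths (cell_diag c) => es.
have in_box (z : int) : (- (box_N a d)%:Z <= z <= (box_N a d)%:Z)%R ->
    z \in box_rng a d.
  move=> zb; apply/mapP; exists (absz (z + (box_N a d)%:Z)%R); last by lia.
  by rewrite mem_iota; lia.
rewrite (in_region_diag _ cR); set j := (_ - _)%R.
apply/flatten_mapP; exists (c.1.1, j); last by case: (c.2) => [[]|]; rewrite !inE eqxx ?orbT.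
apply/allpairsP; exists (c.1.1, j); split=> //; apply: in_box; rewrite /box_N /j /=; lia.
Qed.

(** * The region as a layered graph *)

Definition rrow (x : RCell a d) : nat := cell_row (val x).
Definition rpos (x : RCell a d) : nat := cell_pos (val x).
Definition radj (x y : RCell a d) : bool := adjacent (val x) (val y).
Definition row_lo r := souths (diag r).
Definition row_hi r := a + easts (diag r).

Lemma valR (x : RCell a d) : in_region a d (val x).
Proof. by rewrite -mem_region_seq (valP x). Qed.

Lemma radj_irr : irreflexive radj.
Proof. by move=> x; rewrite /radj /adjacent eqxx. Qed.

Lemma radj_sym : symmetric radj.
Proof.
by move=> x y; rewrite /radj /adjacent eq_sym; congr (_ && _); apply: has_sym.
Qed.

Lemma rcell_inj x y : rrow x = rrow y -> rpos x = rpos y -> x = y.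
Proof.
move=> er ep; apply: val_inj; move: er ep; rewrite /rrow /rpos.
have xR := valR x; have yR := valR y => er ep.
have es := diag_cell_row _ xR; rewrite er (diag_cell_row _ yR) in es.
have [_ px ix _] := in_region_bounds _ xR; have [_ py iy _] := in_region_bounds _ yR.
rewrite (in_region_diag _ xR) (in_region_diag _ yR) es.
have -> : (val x).1.1 = (val y).1.1 by apply: (addIr (a%:Z)%R); rewrite ix iy ep.
rewrite es in py; congr (_, _, _); move: px er; rewrite /cell_row es py => + /addnI.
by case: (val x).2 => [[]|]; case: (val y).2 => [[]|].
Qed.

(** The diagonal l' is not drawn in, so it carries a single row, the last one. *)
Lemma rrow_le x : rrow x <= upper_row N.
Proof.
have [sN pR _ _] := in_region_bounds _ (valR x).
have [sL|] := ltnP (cell_diag (val x)) N.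
  have : upper_row (cell_diag (val x)).+1 <= upper_row N.
    by case: (ltngtP (cell_diag (val x)).+1 N) sL => [/ltn_upper_row /ltnW||->].
  rewrite upper_rowS lower_rowE /rrow /cell_row.
  by rewrite pR; case: (val x).2 => [[]|] /=; lia.
move=> Ns; have sE : cell_diag (val x) = N by lia.
rewrite /rrow /cell_row; move: pR; rewrite sE; case: (val x).2 => [b|] /=.
  by move=> /is_drawn_bounds; rewrite ltnn andbF.
by rewrite addn0.
Qed.

Lemma rpos_in_row x : row_lo (rrow x) <= rpos x < row_hi (rrow x).
Proof.
have [_ _ _ b] := in_region_bounds _ (valR x).
by rewrite /row_lo /row_hi /rrow diag_cell_row ?valR.
Qed.

Lemma rcell_ex r q : r <= upper_row N -> row_lo r <= q < row_hi r ->
  exists2 x, rrow x = r & rpos x = q.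
Proof.
move=> rL rq; pose s := diag r.
have := diag_bounds r; rewrite -/s => /andP[sr rs].
have sN : s <= N.
  by rewrite leqNgt; apply/negP=> /ltn_upper_row; lia.
pose i : int := (q%:Z - a%:Z)%R.
pose c : cell := (i, (i - s%:Z)%R, if is_drawn s then Some (r == upper_row s) else None).
have cR : c \in region_seq a d.
  rewrite mem_region_seq in_regionE sN /=; move: rq; rewrite /row_lo /row_hi -/s /i.
  by case: (is_drawn s) => /=; lia.
have cs : cell_diag c = s by rewrite /cell_diag /c /=; lia.
exists (SeqSub cR); rewrite /rrow /rpos /=.
  rewrite /cell_row cs /c /=; move: rs; rewrite lower_rowE.
  by case: (is_drawn s) => /=; [case: (r =P upper_row s) => /= | ]; lia.
by rewrite /cell_pos /= /i subrK.
Qed.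

Lemma radj_rows x y : rrow x <= rrow y ->
  radj x y = (rrow y == (rrow x).+1) &&
    ((rpos y == rpos x) || ~~ hypotenuse_step (rrow x) && (rpos y == (rpos x).+1)).
Proof.
have xR := valR x; have yR := valR y.
have [_ px ix _] := in_region_bounds _ xR; have [_ py iy _] := in_region_bounds _ yR.
have -> : radj x y = adjacent
    ((val x).1.1, (val x).1.1 - (cell_diag (val x))%:Z, (val x).2)%R
    ((val y).1.1, (val y).1.1 - (cell_diag (val y))%:Z, (val y).2)%R.
  by rewrite /radj -(in_region_diag _ xR) -(in_region_diag _ yR).
rewrite /hypotenuse_step.
rewrite /rrow (diag_cell_row _ xR) /rpos -/(rpos x) -/(rpos y).
move: px py ix iy; rewrite -/(rpos x) -/(rpos y) /cell_row.
move: (cell_diag (val x)) (cell_diag (val y)) (rpos x) (rpos y) => s t k l.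
move: (val x).1.1 (val y).1.1 (val x).2 (val y).2 => i j p q px py ix jy le.
have st : s <= t.
  rewrite leqNgt; apply/negP=> ts.
  have : upper_row t.+1 <= upper_row s.
    by case: (ltngtP t.+1 s) ts => [/ltn_upper_row /ltnW||->].
  by rewrite upper_rowS lower_rowE py; move: le; case: (q) => [[]|] /=; lia.
rewrite adjacent_below; last by lia.
have subK (u v : int) : (u - (u - v) = v)%R by ring.
rewrite !subK px.
have upE : upper_row s.+1 = (upper_row s + isSome p).+1.
  by rewrite upper_rowS lower_rowE px.
case: (ltngtP s t) st => // [lt|e] _; last first.
  subst t; rewrite px in py; clear upE px.
  by case: p q py le => [[]|] [[]|] //= _; lia.
(* Beyond the next diagonal the row numbers differ by more than one, so both sides are false. *)
have upt : if t == s.+1 then upper_row t = upper_row s.+1 else upper_row s.+1 < upper_row t.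
  by case: eqP => [->//|ne]; apply: ltn_upper_row; lia.
clear px py.
by case: p q upE le => [[]|] [[]|] /= upE _; case: eqP upt => [et|ne] upt; lia.
Qed.

Lemma edge_step_bounds r : ~~ hypotenuse_step r ->
  row_lo r.+1 = row_lo r + odd r /\ row_hi r.+1 = row_hi r + ~~ odd r.
Proof.
case/diag_edge_step=> er es; rewrite /row_lo /row_hi es.
by rewrite /souths /easts !big_nat_recr //= -er addnA.
Qed.

(** Black cells fill the odd rows, and a row consists of down-pointing triangles exactly when it is
    reached across hypotenuses. *)
Lemma nregularE :
  nregular a d = #|[set x | odd (rrow x) && ~~ hypotenuse_step (rrow x).-1]|.
Proof.
apply: eq_card => x; rewrite !inE.
have xR := valR x; have [_ px _ _] := in_region_bounds _ xR.
have -> : black d (val x) = odd (rrow x).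
  rewrite /rrow /cell_row {1}(in_region_diag _ xR) /black subKr /upper_row.
  by rewrite -!PoszD.
case odx: (odd (rrow x)) => //=; congr (~~ _).
have := diag_cell_row _ xR; rewrite -/(rrow x) => ds.
case er: (rrow x) odx => [|r] //= _.
have rE : r.+1 = upper_row (cell_diag (val x)) + ((val x).2 == Some false).
  by rewrite -er.
apply/eqP/idP => [pE|hr].
  rewrite pE /= addn1 in rE px; case: rE => rE.
  have dr : diag r = cell_diag (val x).
    by apply: diag_eq; rewrite lower_rowE rE leqnn leq_addr.
  by rewrite /hypotenuse_step dr px rE eqxx.
have := diag_hypotenuse_step _ hr; rewrite -er ds => dr.
move: hr px rE; rewrite /hypotenuse_step -dr => /andP[-> /eqP <-].
by case: (val x).2 => [[]|] //= _; lia.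
Qed.

End Geometry.

Theorem theorem1p1 (a : nat) (d : seq nat) :
  (0 < a)%N -> (0 < size d)%N -> all (fun di => 0 < di)%N d ->
  (* l' passes through white unit squares *)
  (forall i j : int, i - j = (dist_ll' d)%:Z -> ~~ black d (i, j, None)) ->
  (* the southwestern and northeastern boundaries do not intersect *)
  (forall s s' : nat, (s <= dist_ll' d)%N -> (s' <= dist_ll' d)%N ->
     ne d s != sw a d s') ->
  (* B and D lie on the same horizontal line *)
  (ptB d).2 = (ptD a).2 ->
  (ntilings a d)%:R = (2 : rat) ^ ((nregular a d)%:Z
                         - ((width a d * (width a d).+1) %/ 2)%N%:Z).
Proof.
move=> _ _ d_gt0 whiteB _ BD; set N := dist_ll' d in whiteB *.
have Leven : ~~ odd (upper_row d N).
  have := whiteB N%:Z 0 (subr0 _); rewrite /black subr0 addr0.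
  by rewrite /upper_row -PoszD.
(* The ordinates of B and D are [- souths d N] and [- a]. *)
have aE : souths d N = a.
  by move: BD; rewrite /ptB /ptD neE //= => /oppr_inj [].
(* With [a] south steps, C has abscissa 0. *)
have wE : width a d = easts d N.
  by rewrite /width /ptC /ptB /sw neE //= -/N aE; lia.
have diag0 : diag d 0 = 0%N by apply: diag_eq => //; rewrite upper_row0.
have diagL : diag d (upper_row d N) = N.
  by apply: diag_eq => //; rewrite leqnn lower_rowE // leq_addr.
have lo0 : row_lo d 0 = 0%N by rewrite /row_lo diag0 /souths big_geq.
have hyp_step r : (r < upper_row d N)%N -> hypotenuse_step d r ->
    row_lo d r.+1 = row_lo d r /\ row_hi a d r.+1 = row_hi a d r.
  by move=> _ hr; rewrite /row_lo /row_hi diag_hypotenuse_step.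
have even_ends r : (r < upper_row d N)%N -> even_step (hypotenuse_step d) r ->
    row_lo d r.+1 = row_lo d r /\ row_hi a d r.+1 = (row_hi a d r).+1.
  move=> _ /andP[/negPf er hr]; have := edge_step_bounds a d d_gt0 r hr.
  by rewrite er addn0 addn1.
have odd_ends r : (r < upper_row d N)%N -> odd_step (hypotenuse_step d) r ->
    row_lo d r.+1 = (row_lo d r).+1 /\ row_hi a d r.+1 = row_hi a d r.
  move=> _ /andP[er hr]; have := edge_step_bounds a d d_gt0 r hr.
  by rewrite er addn0 addn1.
(* At the bottom row these bounds identify the number of even steps with [easts d N], the width, and
   that of odd steps with [a]. *)
have [] := layer_bounds _ _ _ _ hyp_step even_ends odd_ends _ (leqnn _).
set L := upper_row d N in Leven diagL hyp_step even_ends odd_ends *.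
have -> : odd_steps_from L (hypotenuse_step d) L = 0%N.
  by rewrite /odd_steps_from big_geq.
have hi0 : row_hi a d 0 = a by rewrite /row_hi diag0 /easts big_geq // addn0.
rewrite hi0 lo0 add0n addn0 /row_hi /row_lo diagL aE => /addnI eN aS.
have cells := rcell_ex a d d_gt0; rewrite -/L in cells.
have inj := rcell_inj a d d_gt0.
have le := rrow_le a d d_gt0; rewrite -/L in le.
have inrow := rpos_in_row a d d_gt0.
have -> : (ntilings a d)%:R = 2 ^+ weight_from L (hypotenuse_step d) 0 :> rat.
  rewrite -(matchings_layers _ _ _ _ _ _ _ _ (radj_irr a d) (radj_sym a d)
    inj le inrow cells (radj_rows a d d_gt0) hyp_step even_ends odd_ends) //.
  by rewrite hi0.
rewrite nregularE //.
rewrite (card_even_step_targets _ _ _ _ _ _ _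
  inj le inrow cells hyp_step even_ends odd_ends) ?hi0 //.
by rewrite -eN wE bin2 -divn2 mulnC PoszD addrK.
Qed.
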